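(* Let $R$ and $S$ be commutative rings with identity, $f:R\to S$ a ring homomorphism (preserving identities), and $J$ a non-zero proper ideal of $S$. Consider the properties: (a) $Z(R)^2=0$; (b) for every $r\in \mathrm{Reg}(R)$ and every $j\in J\setminus\{0\}$, $jf(r)\neq 0$; (c) for every $r\in Z(R)\setminus\{0\}$ and every $j\in J\setminus\{0\}$, $jf(r)=0$; (d) $J^2=0$. Suppose that $R\bowtie^f J$ has finitely many elements. Then the following hold. (1) $\mathrm{diam}(\Gamma(R\bowtie^f J))=0$ if and only if $R$ is a field and $|J\setminus\{0\}|=1$ with $J^2=0$. Moreover, when this is the case, properties (a), (b), (c) and (d) hold. (2) $\mathrm{diam}(\Gamma(R\bowtie^f J))=1$ if and only if either $R\bowtie^f J\cong\mathbb{Z}_2\times\mathbb{Z}_2$ as rings, or properties (a), (b), (c) and (d) hold and $\mathrm{diam}(\Gamma(R\bowtie^f J))>0$. (3) $\mathrm{diam}(\Gamma(R\bowtie^f J))=2$ if and only if $\mathrm{diam}(\Gamma(R\bowtie^f J))>1$ and either (i) $Z(R)$ is an ideal of $R$ and $J\subseteq\mathrm{Nil}(S)$, or (ii) $J\cap\mathrm{Nil}(S)=\{0\}$, $S$ has exactly one prime ideal $\mathfrak q$ that is minimal with the property $J\nsubseteq\mathfrak q$, and $R$ is a domain. (4) $\mathrm{diam}(\Gamma(R\bowtie^f J))=3$ if and only if both of the following hold: (i) $Z(R)$ is not an ideal of $R$ or $J\nsubseteq\mathrm{Nil}(S)$; and (ii) $J\cap\mathrm{Nil}(S)\neq\{0\}$,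 or $S$ has more than one prime ideal $\mathfrak q$ that is minimal with the property $J\nsubseteq\mathfrak q$, or $R$ is not a domain.
   Context: The amalgamation of $R$ with $S$ along $J$ with respect to $f$ is the subring $R\bowtie^f J=\{(r,f(r)+j)\mid r\in R,\ j\in J\}$ of $R\times S$. For a commutative ring $A$, $Z(A)$ is the set of zero-divisors of $A$ (including $0$), $\mathrm{Reg}(A)=A\setminus Z(A)$ is the set of regular elements, and $\mathrm{Nil}(A)$ is the set of nilpotent elements; $Z(A)^2=0$ means $xy=0$ for all $x,y\in Z(A)$ (including $x=y$). The zero-divisor graph $\Gamma(A)$ is the undirected graph with vertex set $Z(A)\setminus\{0\}$ in which distinct vertices $x,y$ are adjacent if and only if $xy=0$. The diameter $\mathrm{diam}(G)$ of a connected graph $G$ is the supremum of the distances (lengths of shortest paths) between its vertices. A prime ideal $\mathfrak q$ of $S$ is ''minimal with the property $J\nsubseteq\mathfrak q$'' if it is a minimal element, under inclusion, of the set of prime ideals of $S$ not containing $J$. $\mathbb{Z}_2$ denotes $\mathbb{Z}/2\mathbb{Z}$. *)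

(* Defs.v *)
From HB Require Import structures.
From mathcomp Require Import all_boot all_order all_algebra.
From mathcomp Require Import boolp classical_sets functions cardinality.
From mathcomp Require Import constructive_ereal.

Set Implicit Arguments.
Unset Strict Implicit.
Unset Printing Implicit Defensive.

Import Order.TTheory GRing.Theory Num.Theory.
Local Open Scope classical_set_scope.
Local Open Scope ring_scope.

Section Graph.
Context {T : eqType}.
Implicit Types (V : set T) (e : rel T).

(* Values in [0, +oo]; the distance is +oo when there is no path from x to y. *)
Definition graph_dist e (x y : T) : \bar int :=
  infimum +oo%E
    [set (size p)%:Z%:E | p in [set p : seq T | path e x p /\ last x p = y]].

Definition graph_diam V e : \bar int :=
  supremum 0%:E [set graph_dist e x y | x in V & y in V].

End Graph.

Section RingNotions.
Variable A : comNzRingType.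

Definition zero_divisors : set A := [set x | exists2 y, y != 0 & x * y = 0].

Definition regular_elements : set A := ~` zero_divisors.

Definition nilpotents : set A := [set x | exists n, x ^+ n = 0].

Definition zdg_vertices : set A := zero_divisors `\ 0.

Definition zdg_edge : rel A := fun x y =>
  `[< [/\ zdg_vertices x, zdg_vertices y, x != y & x * y = 0] >].

Definition zdg_diam : \bar int := graph_diam zdg_vertices zdg_edge.

(* [idealr_closed] includes [1 \notin I], so it means "proper ideal".  For the
   set of zero-divisors of a nonzero ring this is the same as "ideal". *)
Definition is_ideal (I : set A) : Prop := idealr_closed [in I].

Definition is_prime_ideal (q : set A) : Prop :=
  is_ideal q /\ prime_idealr_closed [in q].

Definition minimal_prime_avoiding (J q : set A) : Prop :=
  [/\ is_prime_ideal q, ~ (J `<=` q) &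
      forall p, is_prime_ideal p -> ~ (J `<=` p) -> p `<=` q -> p = q].

Definition is_domain : Prop := GRing.integral_domain_axiom A.

Definition is_field : Prop := forall x : A, x != 0 -> exists y, x * y = 1.

End RingNotions.

Definition ring_isomorphic (A B : nzRingType) : Prop :=
  exists g : {rmorphism A -> B}, bijective g.

(* [J : idealr S] is a proper ideal of [S]. *)
Section Amalgamation.
Context {R S : comNzRingType} (f : {rmorphism R -> S}) (J : idealr S).

Definition amalg_pred : {pred R * S} :=
  fun x => `[< exists r, exists2 j, j \in J & x = (r, f r + j) >].

Lemma amalg_predE x : (x \in amalg_pred) = (x.2 - f x.1 \in J).
Proof.
apply/asboolP/idP => [[r [j jJ ->]] /=|xJ]; first by rewrite addrC addKr.
by exists x.1, (x.2 - f x.1) => //; rewrite addrC subrK; case: x {xJ}.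
Qed.

Lemma amalg_subring_closed : subring_closed amalg_pred.
Proof.
split=> [|x y|x y]; rewrite !amalg_predE /=.
- by rewrite rmorph1 subrr rpred0.
- by move=> xJ yJ; rewrite rmorphB opprD addrACA -opprD rpredB.
- move=> xJ yJ; rewrite rmorphM.
  have -> : x.2 * y.2 - f x.1 * f y.1
          = x.2 * (y.2 - f y.1) + f y.1 * (x.2 - f x.1).
    by rewrite !mulrBr (mulrC (f y.1) x.2) (mulrC (f y.1) (f x.1)) addrA subrK.
  by rewrite rpredD // idealMr.
Qed.

HB.instance Definition _ :=
  GRing.isSubringClosed.Build (R * S)%type amalg_pred amalg_subring_closed.

Record amalg := Amalg {
  amalg_val : R * S;
  amalg_valP : amalg_val \in amalg_pred }.

HB.instance Definition _ := [isSub for amalg_val].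
HB.instance Definition _ := [Choice of amalg by <:].
HB.instance Definition _ := [SubChoice_isSubComNzRing of amalg by <:].

End Amalgamation.

(* Main.v *)
Require Import Defs.
From HB Require Import structures.
From mathcomp Require Import all_boot all_order all_algebra.
From mathcomp Require Import boolp classical_sets functions cardinality.
From mathcomp Require Import constructive_ereal.
From mathcomp Require Import zify ring.

(** Every element of a finite commutative ring has an idempotent power, so it
    is a unit or a zero-divisor, and a zero-divisor that is not nilpotent has a
    power that is an idempotent other than [0] and [1]. Distances in the
    zero-divisor graph of any commutative ring are at most 3
    ([zdg_within3]), so the diameter is the least [k] such that any two vertices
    are joined by a walk of length at most [k], and it remains to decide this
    for [k = 0], [1] and [2] in the amalgamation [A].

    For [k = 0] there is one vertex [(0, j)], and all other nonzero elements are
    units.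
    For [k = 1], a ring with a complete zero-divisor graph satisfies
    [Z(A)^2 = 0] or is a product of two copies of Z/2 ([complete_zdg]);
    [Z(A)^2 = 0] spells out as (a), (b), (c), (d) on elements of [R] and [J]
    ([square0_zero_divisors]).

    For [k = 2] ([within2_amalg]) there are two ways to succeed. If all
    zero-divisors of [A] are nilpotent, any two of them have a common nonzero
    annihilator ([nilpotent_common_annihilator]); this is the case where [Z(R)]
    is an ideal and [J] is nil ([nilpotent_zero_divisors]). Otherwise [A] has a
    nontrivial idempotent [e], and walks of length 2 force both factors [A e]
    and [A (1 - e)] to be fields ([diam2_factor_field]). One of the factors is
    then [J], a field with its own unit element, and [R] is a domain
    ([product_of_fields_ideal]); conversely such an [A] has a complete bipartite
    graph ([field_domain_within2]).

    It remains to read off from primes that [J] is a field. For finite [J]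
    without nonzero nilpotents, the primes of [S] minimal among those not
    containing [J] are annihilators of the minimal nonzero idempotents of [J],
    and there is only one of those exactly when [J] is a field
    ([unique_minimal_prime_field], [field_unique_minimal_prime]). The explicit
    description by annihilators spares any use of maximal ideals in [S], which
    may be infinite. *)

Set Implicit Arguments.
Unset Strict Implicit.
Unset Printing Implicit Defensive.

Import Order.TTheory GRing.Theory Num.Theory.
Local Open Scope classical_set_scope.
Local Open Scope ring_scope.

(** * Distances in a graph *)

Section Distances.

Lemma infimum_min d (T : orderType d) (x0 m : T) (A : set T) :
  A m -> lbound A m -> infimum x0 A = m.
Proof.
move=> Am lbm; rewrite /infimum ifF; last by apply/eqP => A0; rewrite A0 in Am.
apply: xget_unique => [|y [lby gby]]; first by split=> // y /(_ m Am).
by apply/eqP; rewrite eq_le lby //= gby.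
Qed.

Lemma supremum_max d (T : orderType d) (x0 m : T) (A : set T) :
  A m -> ubound A m -> supremum x0 A = m.
Proof.
move=> Am ubm; rewrite /supremum ifF; last by apply/eqP => A0; rewrite A0 in Am.
apply: xget_unique => [|y [uby lby]]; first by split=> // y /(_ m Am).
by apply/eqP; rewrite eq_le lby //= uby.
Qed.

Variables (T : eqType) (V : set T) (e : rel T).

Definition within (k : nat) (x y : T) : Prop :=
  exists p : seq T, [/\ path e x p, last x p = y & (size p <= k)%N].

Lemma graph_distP n x y : within n x y ->
  exists m : nat, graph_dist e x y = m%:Z%:E /\
    forall k, (m <= k)%N <-> within k x y.
Proof.
move=> [p0 [ep0 lp0 _]].
pose P k := `[< within k x y >].
have exP : exists k, P k by exists (size p0); apply/asboolP; exists p0.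
case: (ex_minnP exP) => m /asboolP wm minm; exists m; split; last first.
  move=> k; split=> [mk|wk]; last by apply: minm; apply/asboolP.
  by case: wm => p [? ? pm]; exists p; split=> //; apply: leq_trans pm mk.
apply: infimum_min => [|_ [q [eq lq] <-]].
  case: wm => p [ep lp pm]; exists p => //; congr (_%:Z%:E).
  by apply/eqP; rewrite eqn_leq pm minm //; apply/asboolP; exists p.
by rewrite lee_fin lez_nat; apply: minm; apply/asboolP; exists q.
Qed.

(** When the distances on [V] are bounded, the supremum is attained, so the
    diameter is a natural number and is governed by the sublevel predicates
    [within]; every later argument only uses those. *)
Lemma graph_diamP n : (forall x y, V x -> V y -> within n x y) ->
  exists m : nat, graph_diam V e = m%:Z%:E /\
    forall k, (m <= k)%N <-> (forall x y, V x -> V y -> within k x y).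
Proof.
move=> wn.
pose P k := `[< forall x y, V x -> V y -> within k x y >].
have exP : exists k, P k by exists n; apply/asboolP.
case: (ex_minnP exP) => m /asboolP wm minm; exists m; split; last first.
  move=> k; split=> [mk x y Vx Vy|wk]; last by apply: minm; apply/asboolP.
  by have [p [? ? pm]] := wm x y Vx Vy; exists p; split=> //; apply: leq_trans pm mk.
have ub : ubound [set graph_dist e x y | x in V & y in V] m%:Z%:E.
  move=> _ [x Vx [y Vy <-]].
  have [d [-> dP]] := graph_distP (wm x y Vx Vy).
  by rewrite lee_fin lez_nat; apply/dP/wm.
case: m => [|m] in wm minm ub *.
  have [V0|/set0P[x Vx]] := eqVneq V set0.
    rewrite /graph_diam /supremum ifT //; apply/eqP.
    by rewrite V0 -subset0 => z [x []].
  apply: supremum_max => //; exists x => //; exists x => //.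
  have [d [-> dP]] := graph_distP (wm x x Vx Vx).
  by congr (_%:Z%:E); apply/eqP; rewrite -leqn0; apply/dP/wm.
have [x [y [Vx Vy nw]]] : exists x y, [/\ V x, V y & ~ within m x y].
  apply: contrapT => H; have /minm : P m; last by rewrite ltnn.
  by apply/asboolP => x y Vx Vy; apply: contrapT => nw; apply: H; exists x, y.
apply: supremum_max => //; exists x => //; exists y => //.
have [d [-> dP]] := graph_distP (wm x y Vx Vy).
congr (_%:Z%:E); apply/eqP; rewrite eqn_leq; apply/andP; split.
  exact/dP/wm.
by rewrite ltnNge; apply/negP => /dP.
Qed.

End Distances.

(** * Zero-divisors of commutative rings *)

Section ZeroDivisorGraph.
Variable A : comNzRingType.
Implicit Types x y z a b : A.

Lemma zero_divisorI x y : y != 0 -> x * y = 0 -> zero_divisors x.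
Proof. by move=> y0 xy; exists y. Qed.

Lemma unit_not_zero_divisor x y : x * y = 1 -> ~ zero_divisors x.
Proof.
move=> xy [z /eqP z0 xz]; apply: z0.
by rewrite -[z]mul1r -xy mulrAC xz mul0r.
Qed.

Lemma zdg_edgeI x y : x != 0 -> y != 0 -> x != y -> x * y = 0 -> zdg_edge x y.
Proof.
move=> x0 y0 xy xy0; apply/asboolP; split=> //; split; try exact/eqP.
  exact: zero_divisorI xy0.
by apply: (@zero_divisorI _ x) => //; rewrite mulrC.
Qed.

(** Walks may be written down without checking that their consecutive vertices
    are distinct: the steps that stay in place are dropped. *)
Lemma walk_within x (p : seq A) :
  x != 0 -> all (fun z => z != 0) p -> path (fun y z => y * z == 0) x p ->
  within (@zdg_edge A) (size p) x (last x p).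
Proof.
elim: p x => [|z p IH] x x0 /=; first by exists [::].
move=> /andP[z0 p0] /andP[/eqP xz zp].
have [q [eq lq sq]] := IH z z0 p0 zp.
have [xz'|xz'] := eqVneq x z.
  by exists q; rewrite xz'; split=> //; apply: leq_trans sq _.
by exists (z :: q); split=> //=; rewrite eq zdg_edgeI.
Qed.

Lemma within0P x y : within (@zdg_edge A) 0 x y <-> x = y.
Proof.
split=> [[p [_ <-]]|->]; first by rewrite leqn0 size_eq0 => /eqP ->.
by exists [::].
Qed.

Lemma within1P x y : zdg_vertices x -> zdg_vertices y ->
  within (@zdg_edge A) 1 x y <-> x = y \/ x * y = 0.
Proof.
move=> [_ /eqP x0] [_ /eqP y0]; split=> [[[|z [|? ?]] [/= e <-]] // _|].
- by left.
- by right; move: e; rewrite andbT => /asboolP[].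
case=> [->|xy]; first by exists [::].
by have := @walk_within x [:: y] x0; rewrite /= y0 xy eqxx; apply.
Qed.

Lemma within2P x y : zdg_vertices x -> zdg_vertices y ->
  within (@zdg_edge A) 2 x y <->
  x * y = 0 \/ exists z, [/\ z != 0, x * z = 0 & z * y = 0].
Proof.
move=> [[u u0 xu] /eqP x0] [_ /eqP y0]; split.
  case=> [[|z [|t [|? ?]]] [/= e <-]] // _.
  - by right; exists u; rewrite [u * x]mulrC.
  - by left; move: e; rewrite andbT => /asboolP[].
  right; exists z; move: e => /and3P[/asboolP[_ [_ /eqP z0] _ xz]].
  by move=> /asboolP[].
case=> [xy|[z [z0 xz zy]]].
  by have := @walk_within x [:: y] x0; rewrite /= y0 xy eqxx
     => /(_ isT isT)[p [? ? sp]]; exists p; split=> //; apply: leq_trans sp _.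
by have := @walk_within x [:: z; y] x0; rewrite /= y0 z0 xz zy eqxx; apply.
Qed.

(** With [a] and [b] annihilating [x] and [y], either [x, a, b, y] or
    [x, a * b, y] is a walk. *)
Lemma zdg_within3 x y : zdg_vertices x -> zdg_vertices y ->
  within (@zdg_edge A) 3 x y.
Proof.
move=> [[a a0 xa] /eqP x0] [[b b0 yb] /eqP y0].
have [ab|ab] := eqVneq (a * b) 0.
  have := @walk_within x [:: a; b; y] x0.
  by rewrite /= a0 b0 y0 xa ab [b * y]mulrC yb eqxx; apply.
have /= := @walk_within x [:: a * b; y] x0.
rewrite ab y0 mulrA xa mul0r -mulrA [b * y]mulrC yb mulr0 eqxx => W.
by have [p [? ? sp]] := W isT isT; exists p; split=> //; apply: leq_trans sp _.
Qed.

Lemma zdg_diamP : exists m : nat, zdg_diam A = m%:Z%:E /\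
  forall k, (m <= k)%N <->
    forall x y, zdg_vertices x -> zdg_vertices y -> within (@zdg_edge A) k x y.
Proof. exact: graph_diamP zdg_within3. Qed.

End ZeroDivisorGraph.

(** * Complete zero-divisor graphs *)

Section CompleteGraph.
Variable A : comNzRingType.
Implicit Types x y a e : A.

(** Each of [A e] and [A (1 - e)] has only its zero and its unit element, so
    the two coordinates of [a] record whether it is nonzero in each factor. *)
Lemma idempotent_pair_Z2 e :
  e * e = e -> e != 0 -> e != 1 ->
  (forall a, a * e = 0 \/ a * e = e) ->
  (forall a, a * (1 - e) = 0 \/ a * (1 - e) = 1 - e) ->
  ring_isomorphic A ('Z_2 * 'Z_2)%type.
Proof.
have hom (u : A) : u != 0 -> (forall a, a * u = 0 \/ a * u = u) ->
    let h a : 'Z_2 := (a * u != 0)%:R in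
    [/\ {morph h : a b / a - b}, h 1 = 1 & {morph h : a b / a * b}].
  move=> u0 Hu h.
  have uu : u + u = 0.
    have [] := Hu (1 + 1); rewrite mulrDl mul1r // => /eqP.
    by rewrite -subr_eq0 addrK (negbTE u0).
  split=> [a b||a b]; rewrite /h ?mul1r ?u0 //.
    rewrite mulrBl; case: (Hu a) => ->; case: (Hu b) => ->;
      rewrite ?subrr ?sub0r ?subr0 ?oppr_eq0 ?eqxx ?u0 //; exact/eqP.
  rewrite -mulrA; case: (Hu b) => ->; first by rewrite !mulr0 eqxx mulr0.
  by rewrite u0 mulr1.
move=> ee e0 e1 He Hf.
have f0 : 1 - e != 0 by rewrite subr_eq0 eq_sym.
have [hB h1 hM] := hom e e0 He; have [kB k1 kM] := hom _ f0 Hf.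
pose g a : 'Z_2 * 'Z_2 := ((a * e != 0)%:R, (a * (1 - e) != 0)%:R).
have gB : {morph g : a b / a - b} by move=> a b; rewrite /g hB kB.
have gM : monoid_morphism g.
  by split; [rewrite /g h1 k1 | move=> a b; rewrite /g hM kM].
pose gZ := GRing.isZmodMorphism.Build _ _ g gB.
pose gR := GRing.isMonoidMorphism.Build _ _ g gM.
pose G : {rmorphism A -> 'Z_2 * 'Z_2} := HB.pack g gZ gR.
pose k (c : 'Z_2 * 'Z_2) := e *+ c.1 + (1 - e) *+ c.2.
have ef : e * (1 - e) = 0 by rewrite mulrBr mulr1 ee subrr.
have ff : (1 - e) * (1 - e) = 1 - e.
  by rewrite {1}mulrBl mul1r ef subr0.
exists G, k.
  move=> a; rewrite /= /k /g /=.
  have -> : a = a * e + a * (1 - e) by rewrite -mulrDr addrC subrK mulr1.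
  rewrite !mulrDl -!mulrA ee ff [(1 - e) * e]mulrC ef !mulr0 addr0 add0r.
  by case: (He a) => ->; case: (Hf a) => ->; rewrite ?eqxx ?e0 ?f0 ?mulr0n ?mulr1n.
have z2 (c : 'Z_2) : c = 0 \/ c = 1.
  by case: c => [[|[|//]] ?]; [left|right]; apply: val_inj.
case=> c d; rewrite /= /k /g /= !mulrDl !mulrnAl ee ff ef [(1 - e) * e]mulrC ef.
by case: (z2 c) => ->; case: (z2 d) => ->;
  rewrite !mul0rn ?addr0 ?add0r ?mulr0n ?mulr1n ?eqxx ?e0 ?f0.
Qed.

(** Suppose [x] is a zero-divisor with [x * x != 0]. Were [x * x != x], then
    [x ^+ 3 = 0] and [x] would be adjacent to [x + x * x], so [x * x = 0].
    Hence [x] is idempotent, and a multiple of [x] different from [0] and [x]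
    would be adjacent to [x], although [x] acts as the identity on it. *)
Lemma complete_zdg :
  (forall x y, zdg_vertices x -> zdg_vertices y -> x = y \/ x * y = 0) ->
  (forall x y, @zero_divisors A x -> zero_divisors y -> x * y = 0)
  \/ ring_isomorphic A ('Z_2 * 'Z_2)%type.
Proof.
move=> cpl.
have cplz x y : zero_divisors x -> zero_divisors y -> x = y \/ x * y = 0.
  move=> zx zy; have [->|/eqP x0] := eqVneq x 0; first by right; rewrite mul0r.
  have [->|/eqP y0] := eqVneq y 0; first by right; rewrite mulr0.
  exact: cpl.
have zmul x y : zero_divisors x -> zero_divisors (x * y).
  by move=> [z z0 xz]; exists z => //; rewrite mulrAC xz mul0r.
have [sq0|] := pselect (forall x, @zero_divisors A x -> x * x = 0).
  by left=> x y zx zy; case: (cplz _ _ zx zy) => // <-; exact: sq0.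
move=> /existsNP[e /not_implyP[ze /eqP ee0]]; right.
have ee : e * e = e.
  case: (cplz (e * e) e (zmul _ _ ze) ze) => // e3.
  have ze2 : zero_divisors (e + e * e).
    by rewrite -[X in X + _]mulr1 -mulrDr; exact: zmul.
  have e2 : e * (e + e * e) = e * e by rewrite mulrDr mulrA e3 addr0.
  case: (cplz _ _ ze ze2) => [/eqP|]; last by rewrite e2 => /eqP; rewrite (negbTE ee0).
  by rewrite -subr_eq0 opprD addNKr oppr_eq0 (negbTE ee0).
have e0 : e != 0 by rewrite -ee.
have e1 : e != 1.
  by apply/eqP => e1; apply: (@unit_not_zero_divisor _ e 1) ze; rewrite mulr1.
have zf : zero_divisors (1 - e).
  by apply: (@zero_divisorI _ _ e); rewrite // mulrBl mul1r ee subrr.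
have mult (u : A) : u * u = u -> zero_divisors u -> forall a, a * u = 0 \/ a * u = u.
  move=> uu zu a.
  have zau : zero_divisors (a * u) by rewrite mulrC; exact: zmul.
  by case: (cplz _ _ zau zu) => [|]; [right|rewrite -mulrA uu; left].
apply: (@idempotent_pair_Z2 e) => //; apply: mult => //.
by rewrite mulrBl mul1r mulrBr ee mulr1 subrr subr0.
Qed.

Lemma Z2xZ2_not_within0 : ring_isomorphic A ('Z_2 * 'Z_2)%type ->
  ~ forall x y, zdg_vertices x -> zdg_vertices y -> within (@zdg_edge A) 0 x y.
Proof.
move=> [g [h gK hK]] w0.
have h0 u : u != 0 -> h u != 0.
  by apply: contra_neq => hu; rewrite -(hK u) hu rmorph0.
have hM u v : u * v = 0 -> h u * h v = 0.
  by move=> uv; apply: (can_inj gK); rewrite rmorphM !hK uv rmorph0.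
have hV u v : u != 0 -> v != 0 -> u * v = 0 -> zdg_vertices (h u).
  move=> u0 v0 /hM uv; split; last exact/eqP/h0.
  exact: zero_divisorI (h0 v v0) uv.
have uv : (1, 0) * (0, 1) = 0 :> 'Z_2 * 'Z_2.
  by apply: injective_projections; rewrite /= ?mulr0 ?mul0r.
have vu : (0, 1) * (1, 0) = 0 :> 'Z_2 * 'Z_2 by rewrite mulrC.
have /within0P/(can_inj hK) // := w0 _ _ (hV (1, 0) (0, 1) isT isT uv)
  (hV (0, 1) (1, 0) isT isT vu).
Qed.

End CompleteGraph.

(** * Finite commutative rings *)

(** By the pigeonhole principle [x ^+ (m + p) = x ^+ m] for all large [m], and
    any large multiple of the period [p] is an idempotent exponent. *)
Lemma idempotent_power (B : comNzRingType) (X : set B) (x : B) :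
  finite_set X -> (forall n, X (x ^+ n.+1)) ->
  exists n, x ^+ n.+1 * x ^+ n.+1 = x ^+ n.+1.
Proof.
move=> /finite_seqP[s Xs] Xx.
have [i [p xip]] : exists i p, x ^+ (i.+1 + p.+1) = x ^+ i.+1.
  apply: contrapT => H.
  pose t := [seq x ^+ n.+1 | n <- iota 0 (size s).+1].
  have ut : uniq t.
    rewrite map_inj_in_uniq ?iota_uniq // => i j _ _ /= xij; apply/eqP.
    have [ij|ji|//] := ltngtP i j; exfalso; apply: H.
      exists i, (j - i.+1)%N; rewrite xij.
      by congr (_ ^+ _); lia.
    exists j, (i - j.+1)%N; rewrite -xij.
    by congr (_ ^+ _); lia.
  have /(uniq_leq_size ut) : {subset t <= s}.
    by move=> _ /mapP[n _ ->]; have := Xx n; rewrite Xs.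
  by rewrite size_map size_iota ltnn.
have per k m : (i < m)%N -> x ^+ (m + k * p.+1) = x ^+ m.
  move=> im; elim: k => [|k IH]; first by rewrite addn0.
  rewrite mulSn -[RHS]IH.
  have -> : (m + (p.+1 + k * p.+1) = (i.+1 + p.+1) + (m + k * p.+1 - i.+1))%N by lia.
  by rewrite exprD xip -exprD; congr (_ ^+ _); lia.
exists (i.+1 * p.+1).-1; rewrite -exprD prednK ?muln_gt0 // per //.
by rewrite mulnS ltn_addr.
Qed.

(** If [n] and [m] are the largest exponents with [x ^+ n != 0] and
    [x ^+ n * y ^+ m != 0], then the latter product annihilates both. *)
Lemma nilpotent_common_annihilator (B : comNzRingType) (x y : B) :
  nilpotents x -> nilpotents y ->
  exists z, [/\ z != 0, x * z = 0 & y * z = 0].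
Proof.
have last_power (u w : B) : w != 0 -> nilpotents u ->
    exists n, u ^+ n * w != 0 /\ u * (u ^+ n * w) = 0.
  move=> w0 [k uk].
  have exn : exists n, u ^+ n * w == 0 by exists k; rewrite uk mul0r.
  case: (ex_minnP exn) => [[|n]]; first by rewrite mul1r (negbTE w0).
  move=> /eqP un0 minn; exists n; split; last by rewrite mulrA -exprS.
  by apply/negP => /minn; rewrite ltnn.
move=> xnil ynil.
have [n [xn0 xxn]] := last_power x 1 (oner_neq0 _) xnil.
have [m [ym0 yym]] := last_power y _ xn0 ynil.
by exists (y ^+ m * (x ^+ n * 1)); split=> //; rewrite mulrCA xxn mulr0.
Qed.

Lemma regular_power (B : comNzRingType) (x y : B) n :
  ~ zero_divisors x -> x ^+ n * y = 0 -> y = 0.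
Proof.
move=> xreg; elim: n => [|n IH]; first by rewrite mul1r.
rewrite exprS -mulrA => xy; apply: IH; apply: contrapT => /eqP ny.
by apply: xreg; exact: zero_divisorI ny xy.
Qed.

Section FiniteRing.
Variables (A : comNzRingType) (finA : finite_set [set: A]).
Implicit Types x y a e : A.

(** The idempotent power of a regular element is regular, hence equals [1]. *)
Lemma zero_divisor_or_unit x : zero_divisors x \/ exists y, x * y = 1.
Proof.
have [n xn] := @idempotent_power _ _ x finA (fun=> I).
have [zx|zx] := pselect (zero_divisors x); [by left|right].
have /(regular_power zx)/eqP : x ^+ n.+1 * (1 - x ^+ n.+1) = 0.
  by rewrite mulrBr mulr1 xn subrr.
by rewrite subr_eq0 => /eqP xn1; exists (x ^+ n); rewrite -exprS -xn1.
Qed.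

Lemma nontrivial_idempotent x : zero_divisors x -> ~ nilpotents x ->
  exists n, let e := x ^+ n.+1 in [/\ e * e = e, e != 0 & e != 1].
Proof.
move=> zx nx; have [n xn] := @idempotent_power _ _ x finA (fun=> I).
exists n; split=> //; first by apply/eqP => xn0; apply: nx; exists n.+1.
by apply/eqP => xn1; apply: (@unit_not_zero_divisor _ x (x ^+ n)); rewrite -?exprS.
Qed.

Lemma nilpotent_within2 x y :
  (forall u : A, zero_divisors u -> nilpotents u) ->
  zdg_vertices x -> zdg_vertices y -> within (@zdg_edge A) 2 x y.
Proof.
move=> nil Vx Vy; apply/within2P => //; right.
have [z [z0 xz yz]] := nilpotent_common_annihilator (nil x Vx.1) (nil y Vy.1).
by exists z; rewrite [z * y]mulrC.
Qed.

(** If [a * e] were a nonzero non-unit of the factor [A e], then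
    [x = a * e + (1 - e)] would be a zero-divisor with [x * e != 0], and an
    element annihilating both [x] and [e] lies in [A (1 - e)], on which
    multiplication by [x] is the identity. *)
Lemma diam2_factor_field e a :
  (forall x y, zdg_vertices x -> zdg_vertices y -> within (@zdg_edge A) 2 x y) ->
  e * e = e -> e != 1 -> a * e != 0 -> exists b, a * b * e = e.
Proof.
move=> w2 ee e1 ae0; pose x := a * e + (1 - e).
have xe : x * e = a * e by rewrite /x mulrDl -mulrA mulrBl ee mul1r subrr addr0.
have e0 : e != 0 by apply: contraNneq ae0 => ->; rewrite mulr0.
have [zx|[y xy]] := zero_divisor_or_unit x; last first.
  by exists y; rewrite mulrAC -xe mulrAC xy mul1r.
have Vx : zdg_vertices x.
  by split=> // x0; move: ae0; rewrite -xe x0 mul0r eqxx.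
have Ve : zdg_vertices e.
  split; last exact/eqP.
  apply: (@zero_divisorI _ e (1 - e)); first by rewrite subr_eq0 eq_sym.
  by rewrite mulrBr ee mulr1 subrr.
case/(within2P Vx Ve): (w2 x e Vx Ve) => [|[z [/eqP z0 xz ze]]].
  by rewrite xe => ae; rewrite ae eqxx in ae0.
case: z0; rewrite -[LHS]subr0 -{1}xz /x.
have -> : z - (a * e + (1 - e)) * z = (1 - a) * (z * e) by ring.
by rewrite ze mulr0.
Qed.

End FiniteRing.

(** * Minimal primes avoiding a finite reduced ideal *)

Section PrimesAvoidingIdeal.
Variables (S : comNzRingType) (J : idealr S).
Implicit Types (q : set S) (e g h j s : S).

Lemma is_idealP (I : set S) : is_ideal I <->
  [/\ I 0, ~ I 1 & forall a u v, I u -> I v -> I (a * u + v)].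
Proof.
split=> [[/set_mem I0 /negP I1 Iadd]|[I0 I1 Iadd]].
  split=> // [I1'|a u v Iu Iv]; first by apply: I1; exact: mem_set.
  by apply: set_mem; apply: Iadd; exact: mem_set.
split; [exact: mem_set|by apply/negP => /set_mem|].
by move=> a u v /set_mem Iu /set_mem Iv; apply: mem_set; exact: Iadd.
Qed.

Lemma is_prime_idealP q : is_prime_ideal q <->
  is_ideal q /\ forall u v, q (u * v) -> q u \/ q v.
Proof.
split=> -[iq pq]; split=> // u v.
  by move=> /mem_set/pq/orP[] /set_mem; [left|right].
by move=> /set_mem/pq[] /mem_set -> //; rewrite orbT.
Qed.

Lemma is_ideal_mul (I : set S) a u : is_ideal I -> I u -> I (a * u).
Proof. by move=> /is_idealP[I0 _ Iadd] Iu; rewrite -[a * u]addr0; exact: Iadd. Qed.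

Definition annihilator e : set S := [set s | s * e = 0].

(** This is what makes the annihilator of [e], once known to be a prime not
    containing [e], the least such prime. *)
Lemma annihilator_sub_prime q e : is_prime_ideal q -> ~ q e -> annihilator e `<=` q.
Proof.
move=> /is_prime_idealP[/is_idealP[q0 _ _] pq] qe s se.
by case: (pq s e) => //; rewrite se.
Qed.

Definition primitive_idempotent e : Prop :=
  [/\ e \in J, e * e = e, e != 0 &
      forall g, g \in J -> g * g = g -> g * e = g -> g = 0 \/ g = e].

Lemma primitive_annihilator_inj e e' :
  primitive_idempotent e -> primitive_idempotent e' ->
  annihilator e = annihilator e' -> e = e'.
Proof.
move=> [eJ ee e0 pe] [e'J ee' e'0 pe'] annE.
have gJ : e * e' \in J by rewrite idealMr.
have gg : (e * e') * (e * e') = e * e' by rewrite mulrACA ee ee'.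
have [|g0|eE] := pe _ gJ gg; first by rewrite mulrAC ee.
  have : annihilator e e' by rewrite /annihilator /= mulrC.
  by rewrite annE /annihilator /= ee' => /eqP; rewrite (negbTE e'0).
have [|g0|] := pe' _ gJ gg; first by rewrite -mulrA ee'.
  by move: e0; rewrite -eE g0 eqxx.
by rewrite eE.
Qed.

Hypothesis finJ : finite_set [set` J].

(** A nonzero idempotent of [J] below [g] that fixes the fewest elements of
    [J] is primitive. *)
Lemma primitive_below g : g \in J -> g * g = g -> g != 0 ->
  exists2 e, primitive_idempotent e & e * g = e.
Proof.
move=> gJ gg g0; have /finite_seqP[t Jt] := finJ.
have Jt' j : (j \in J) = (j \in t).
  by apply/idP/idP => jJ; [have : [set` J] j|have : [set` t] j] => //;
    [rewrite Jt|rewrite -Jt].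
pose fixed e := size [seq y <- undup t | y * e == y].
pose P n := `[< exists e, [/\ e \in J, e * e = e, e != 0, e * g = e & fixed e = n] >].
have exP : exists n, P n by exists (fixed g); apply/asboolP; exists g.
case: (ex_minnP exP) => m /asboolP[e [eJ ee e0 eg <-]] minm.
exists e => //; split=> // h hJ hh he.
have [->|h0] := eqVneq h 0; [by left|right].
have hg : h * g = h by rewrite -he -mulrA eg.
have /minm hm : P (fixed h) by apply/asboolP; exists h.
have uh : uniq [seq y <- undup t | y * h == y] by rewrite filter_uniq // undup_uniq.
have sub : {subset [seq y <- undup t | y * h == y] <= [seq y <- undup t | y * e == y]}.
  move=> y; rewrite !mem_filter => /andP[/eqP yh ->]; rewrite andbT.
  by rewrite -{1}yh -mulrA he yh.
have [_ eqs] := uniq_min_size uh sub hm.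
have : e \in [seq y <- undup t | y * e == y].
  by rewrite mem_filter ee eqxx mem_undup -Jt'.
by rewrite -eqs mem_filter mulrC he => /andP[/eqP].
Qed.

(** Under the operations of [S], whose unit element is not in [J]: the ideal is
    then the direct factor [S e] of [S], with unit element [e]. *)
Definition ideal_is_field e : Prop :=
  [/\ e \in J, e != 0 &
      forall j, j \in J -> j * e = j /\ (j != 0 -> exists k, j * k = e)].

Lemma field_unit_primitive e : ideal_is_field e -> primitive_idempotent e.
Proof.
move=> [eJ e0 H]; split=> //; first by have [] := H e eJ.
move=> g gJ gg ge; have [->|g0] := eqVneq g 0; [by left|right].
by have [_ /(_ g0)[k gk]] := H g gJ; rewrite -ge -gk mulrA gg.
Qed.

Lemma field_ideal_reduced e : ideal_is_field e -> [set` J] `&` @nilpotents S = [set 0].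
Proof.
move=> [eJ e0 H]; apply/seteqP; split=> [j /= [jJ [n jn]]|_ ->]; last first.
  by split; [exact: rpred0|exists 1%N; rewrite expr1].
have [//|j0] := eqVneq j 0; have [ee _] := H e eJ.
have [_ /(_ j0)[k jk]] := H j jJ.
have en m : e ^+ m.+1 = e by elim: m => [//|m IH]; rewrite exprS IH.
case: n jn => [/eqP|n jn]; first by rewrite oner_eq0.
by move: e0; rewrite -(en n) -jk exprMn jn mul0r eqxx.
Qed.

Section Reduced.
Hypothesis redJ : [set` J] `&` @nilpotents S = [set 0].

Lemma reduced_idempotent_power j : j \in J -> j != 0 ->
  exists n, let e := j ^+ n.+1 in [/\ e \in J, e * e = e & e != 0].
Proof.
move=> jJ j0; have XJ n : [set` J] (j ^+ n.+1) by rewrite /= exprSr idealMr.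
have [n jn] := idempotent_power finJ XJ; exists n; split=> //; first exact: XJ.
apply: contraNneq j0 => jn0; have : ([set` J] `&` @nilpotents S) j.
  by split=> //; exists n.+1.
by rewrite redJ => ->.
Qed.

(** If [s * t * e = 0] and [s * e != 0], then the idempotent power of [s * e]
    lies below [e], hence equals [e]; so [s] is invertible on [S e] and
    [t * e = 0]. *)
Lemma annihilator_minimal_prime e : primitive_idempotent e ->
  minimal_prime_avoiding [set` J] (annihilator e).
Proof.
move=> [eJ ee e0 pe].
have nee : ~ annihilator e e by rewrite /annihilator /= ee; exact/eqP.
split; last 2 first.
- by move=> /(_ e eJ).
- move=> p pp _ pe'; apply/seteqP; split=> //.
  by apply: annihilator_sub_prime => // /pe'.
apply/is_prime_idealP; split.
  apply/is_idealP; rewrite /annihilator /=; split=> [||a u v ue ve].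
  - by rewrite mul0r.
  - by rewrite mul1r; exact/eqP.
  - by rewrite mulrDl -mulrA ue ve mulr0 addr0.
move=> s t; rewrite /annihilator /= => ste.
have [se0|se0] := eqVneq (s * e) 0; [by left|right].
have seJ : s * e \in J by rewrite idealMr.
have [n /= [gJ gg g0]] := reduced_idempotent_power seJ se0.
have [|/eqP|gE] := pe _ gJ gg; last 2 first.
- by rewrite (negbTE g0).
- rewrite -ee mulrA -{2}gE exprS.
  by rewrite (_ : t * e * _ = (s * t * e) * (e * (s * e) ^+ n)); [rewrite ste mul0r|ring].
by rewrite exprSr -!mulrA ee.
Qed.

Lemma minimal_prime_avoiding_exists : (exists2 j, j \in J & j != 0) ->
  exists q, minimal_prime_avoiding [set` J] q.
Proof.
move=> [j jJ j0]; have [n /= [gJ gg g0]] := reduced_idempotent_power jJ j0.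
have [e pe _] := primitive_below gJ gg g0.
by exists (annihilator e); exact: annihilator_minimal_prime.
Qed.

(** Distinct primitive idempotents have distinct annihilators, so [J] has a
    single primitive idempotent [e]. Every nonzero idempotent [g] is then [e],
    since otherwise a primitive idempotent lies below [g - g * e]; thus each
    nonzero element of [J] has [e] among its powers. *)
Lemma unique_minimal_prime_field : (exists2 j, j \in J & j != 0) ->
  (exists! q, minimal_prime_avoiding [set` J] q) -> exists e, ideal_is_field e.
Proof.
move=> [j0 j0J j00] [q [_ uq]].
have uprim e e' : primitive_idempotent e -> primitive_idempotent e' -> e = e'.
  move=> pe pe'; apply: primitive_annihilator_inj => //.
  by rewrite -(uq _ (annihilator_minimal_prime pe)); apply: uq;
    exact: annihilator_minimal_prime.
have [n0 /= [g0J gg0 g00]] := reduced_idempotent_power j0J j00.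
have [e pe _] := primitive_below g0J gg0 g00; case: (pe) => eJ ee e0 mine.
have idem_e g : g \in J -> g * g = g -> g != 0 -> g = e.
  move=> gJ gg gn0.
  have gJ' : g - g * e \in J by rewrite rpredB ?idealMr.
  have gg' : (g - g * e) * (g - g * e) = g - g * e.
    have -> : (g - g * e) * (g - g * e)
            = g * g - (g * g) * e - (g * g) * e + (g * g) * (e * e) by ring.
    by rewrite gg ee subrK.
  have [d0|d0] := eqVneq (g - g * e) 0.
    move/eqP: d0; rewrite subr_eq0 => /eqP gE.
    by case: (mine g gJ gg (esym gE)) => // g0; rewrite g0 eqxx in gn0.
  have [e' pe' e'd] := primitive_below gJ' gg' d0.
  move: e'd; rewrite (uprim _ _ pe' pe) => ed; case/negP: e0; rewrite -ed.
  by rewrite mulrBr [g * e]mulrC mulrA ee subrr.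
exists e; split=> // j jJ; split.
  have dJ : j - j * e \in J by rewrite rpredB ?idealMr.
  have [/eqP|d0] := eqVneq (j - j * e) 0; first by rewrite subr_eq0 => /eqP.
  have [n /= [gJ gg gn0]] := reduced_idempotent_power dJ d0.
  case/negP: e0; rewrite -ee -{1}(idem_e _ gJ gg gn0) exprSr -mulrA.
  by rewrite mulrBl -mulrA ee subrr mulr0.
move=> jn0; have [n /= [gJ gg gn0]] := reduced_idempotent_power jJ jn0.
by exists (j ^+ n); rewrite -exprS; exact: idem_e.
Qed.

End Reduced.

(** A prime that avoids [J] cannot contain the unit element [e] of [J], so it
    contains the annihilator of [e]. *)
Lemma field_unique_minimal_prime e : ideal_is_field e ->
  exists! q, minimal_prime_avoiding [set` J] q.
Proof.
move=> fe; have pe := field_unit_primitive fe.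
have mp := annihilator_minimal_prime (field_ideal_reduced fe) pe.
exists (annihilator e); split=> // q [pq Jq minq].
apply: minq; [by case: mp|by case: mp|apply: annihilator_sub_prime => // qe].
apply: Jq => j jJ; have [_ _ /(_ j jJ)[<- _]] := fe.
by case/is_prime_idealP: pq => iq _; exact: is_ideal_mul.
Qed.

End PrimesAvoidingIdeal.

(** * The amalgamation of a finite ring along an ideal *)

Section Amalgamation.
Variables (R S : comNzRingType) (f : {rmorphism R -> S}) (J : idealr S).
Local Notation A := (amalg f J).
Local Notation fst_ x := (amalg_val x).1.
Local Notation snd_ x := (amalg_val x).2.
Implicit Types (x y z t e : A) (r s : R) (i j k : S).

Lemma amalg_eq x y : fst_ x = fst_ y -> snd_ x = snd_ y -> x = y.
Proof.
by move=> xy1 xy2; apply: val_inj; apply: injective_projections.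
Qed.

Lemma amalg_diff x : snd_ x - f (fst_ x) \in J.
Proof. by have := amalg_valP x; rewrite amalg_predE. Qed.

Lemma amalg_snd x : fst_ x = 0 -> snd_ x \in J.
Proof. by move=> x1; have := amalg_diff x; rewrite x1 rmorph0 subr0. Qed.

Lemma amalg_fstX x n : fst_ (x ^+ n) = fst_ x ^+ n.
Proof. by elim: n => [//|n IH]; rewrite !exprS -IH. Qed.

Lemma amalg_sndX x n : snd_ (x ^+ n) = snd_ x ^+ n.
Proof. by elim: n => [//|n IH]; rewrite !exprS -IH. Qed.

Lemma amalg_of_ideal_subproof j : j \in J -> (0, j) \in amalg_pred f J.
Proof. by move=> jJ; rewrite amalg_predE /= rmorph0 subr0. Qed.

Definition amalg_of_ideal j (jJ : j \in J) : A :=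
  Amalg (amalg_of_ideal_subproof jJ).

Lemma amalg_of_ring_subproof r : (r, f r) \in amalg_pred f J.
Proof. by rewrite amalg_predE /= subrr rpred0. Qed.

Definition amalg_of_ring r : A := Amalg (amalg_of_ring_subproof r).

Lemma amalg_of_ideal_neq0 j (jJ : j \in J) : j != 0 -> amalg_of_ideal jJ != 0.
Proof. by apply: contra_neq => /(congr1 (fun x => snd_ x)). Qed.

Lemma amalg_of_ring_neq0 r : r != 0 -> amalg_of_ring r != 0.
Proof. by apply: contra_neq => /(congr1 (fun x => fst_ x)). Qed.

Hypothesis finA : finite_set [set: A].

Lemma finite_base : finite_set [set: R].
Proof.
have -> : [set: R] = [set fst_ x | x in [set: A]].
  by apply/seteqP; split=> // r _; exists (amalg_of_ring r).
exact: finite_image.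
Qed.

Lemma finite_ideal : finite_set [set` J].
Proof.
apply: (@sub_finite_set _ _ [set snd_ x | x in [set: A]]); last exact: finite_image.
by move=> j jJ; exists (amalg_of_ideal jJ).
Qed.

Lemma zero_divisor_lift x : zero_divisors (fst_ x) -> zero_divisors x.
Proof.
move=> zx; have [//|[y xy]] := zero_divisor_or_unit finA x.
have xy1 : fst_ x * fst_ y = 1 := congr1 (fun z => fst_ z) xy.
by case: (unit_not_zero_divisor xy1).
Qed.

Lemma zero_divisor_of_ideal j (jJ : j \in J) : zero_divisors (amalg_of_ideal jJ).
Proof.
by apply: zero_divisor_lift; exists 1; rewrite ?oner_neq0 ?mul0r.
Qed.

Lemma zero_divisor_of_ring r : zero_divisors r -> zero_divisors (amalg_of_ring r).
Proof. by move=> zr; apply: zero_divisor_lift. Qed.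

Lemma vertex_of_ideal j (jJ : j \in J) : j != 0 -> zdg_vertices (amalg_of_ideal jJ).
Proof.
move=> j0; split; [exact: zero_divisor_of_ideal|].
by apply/eqP; exact: amalg_of_ideal_neq0.
Qed.

(** If [r] is a unit and [(r, f r + i)] annihilates [y], then [y = (0, k)] with
    [k] in [J], and [J^2 = 0] leaves [f r * k = 0], so [k = 0]. *)
Lemma square0_zero_divisor_fst x :
  (forall i j, i \in J -> j \in J -> i * j = 0) ->
  zero_divisors x -> zero_divisors (fst_ x).
Proof.
move=> J2 [y y0 xy].
have [//|[s rs]] := zero_divisor_or_unit finite_base (fst_ x).
have xy1 : fst_ x * fst_ y = 0 := congr1 (fun z => fst_ z) xy.
have xy2 : snd_ x * snd_ y = 0 := congr1 (fun z => snd_ z) xy.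
have y1 : fst_ y = 0 by rewrite -[fst_ y]mul1r -rs mulrAC xy1 mul0r.
have y2J := amalg_snd y1; case/eqP: y0; apply: amalg_eq => //.
have xJ : snd_ x - f (fst_ x) \in J by rewrite amalg_diff.
have fy : f (fst_ x) * snd_ y = 0.
  by have := J2 _ _ xJ y2J; rewrite mulrBl xy2 sub0r => /eqP; rewrite oppr_eq0 => /eqP.
by rewrite -[LHS]mul1r -(rmorph1 f) -rs rmorphM mulrAC fy mul0r.
Qed.

Lemma square0_zero_divisors :
  (forall x y, zero_divisors x -> zero_divisors y -> x * y = 0) <->
  [/\ forall r s, zero_divisors r -> zero_divisors s -> r * s = 0,
      forall r j, regular_elements r -> j \in J -> j != 0 -> j * f r != 0,
      forall r j, zero_divisors r -> r != 0 -> j \in J -> j != 0 -> j * f r = 0 &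
      forall i j, i \in J -> j \in J -> i * j = 0].
Proof.
split=> [Z2|[a b c d] x y zx zy].
  split=> [r s zr zs|r j rr jJ|r j zr _ jJ _|i j iJ jJ].
  - exact: (congr1 (fun z => fst_ z)
      (Z2 _ _ (zero_divisor_of_ring zr) (zero_divisor_of_ring zs))).
  - have [/rr[]|[s rs]] := zero_divisor_or_unit finite_base r.
    apply: contra_neq => jr.
    by rewrite -[j]mulr1 -(rmorph1 f) -rs rmorphM mulrA jr mul0r.
  - exact: (congr1 (fun z => snd_ z)
      (Z2 _ _ (zero_divisor_of_ideal jJ) (zero_divisor_of_ring zr))).
  - exact: (congr1 (fun z => snd_ z)
      (Z2 _ _ (zero_divisor_of_ideal iJ) (zero_divisor_of_ideal jJ))).
have zx1 := square0_zero_divisor_fst d zx.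
have zy1 := square0_zero_divisor_fst d zy.
apply: amalg_eq; first exact: a.
have decomp z : exists2 j, j \in J & snd_ z = f (fst_ z) + j.
  exists (snd_ z - f (fst_ z)); last by rewrite addrC subrK.
  exact: amalg_diff.
have [i iJ xE] := decomp x; have [j jJ yE] := decomp y.
have c' k r : zero_divisors r -> k \in J -> k * f r = 0.
  move=> zr kJ; have [->|k0] := eqVneq k 0; first by rewrite mul0r.
  by have [->|r0] := eqVneq r 0; [rewrite rmorph0 mulr0|exact: c].
change (snd_ x * snd_ y = 0); rewrite xE yE mulrDl !mulrDr -rmorphM a // rmorph0.
by rewrite [f _ * j]mulrC !c' // d // !addr0.
Qed.

(** The idempotent power [(u, v)] of a non-nilpotent zero-divisor: when [Z(R)]
    is an ideal, [u] is [0] or [1], so [v] or [1 - v] is an idempotent of [J],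
    hence zero when [J] is nil. *)
Lemma nilpotent_zero_divisors :
  (forall x, zero_divisors x -> nilpotents x) <->
  is_ideal (@zero_divisors R) /\ [set` J] `<=` @nilpotents S.
Proof.
have idem_nil (B : comNzRingType) (u : B) : u * u = u -> nilpotents u -> u = 0.
  move=> uu [[|n] un]; first by case/eqP: (oner_neq0 B).
  suff <- : u ^+ n.+1 = u by [].
  by elim: n {un} => [//|n IH]; rewrite exprS IH.
split=> [nilA|[idR nilJ] x zx].
  split; last first.
    move=> j jJ; have [n xn] := nilA _ (zero_divisor_of_ideal jJ).
    by exists n; have := amalg_sndX (amalg_of_ideal jJ) n; rewrite xn.
  have nilR r : zero_divisors r -> nilpotents r.
    move=> zr; have [n xn] := nilA _ (zero_divisor_of_ring zr).
    by exists n; have := amalg_fstX (amalg_of_ring r) n; rewrite xn.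
  apply/is_idealP; split=> [||a u v zu zv].
  - by exists 1; rewrite ?oner_neq0 ?mul0r.
  - by apply: (@unit_not_zero_divisor _ 1 1); rewrite mulr1.
  have [z [z0 uz vz]] := nilpotent_common_annihilator (nilR u zu) (nilR v zv).
  by exists z; rewrite // mulrDl -mulrA uz vz mulr0 addr0.
apply: contrapT => nx.
have [n /= [ee e0 e1]] := nontrivial_idempotent finA zx nx.
set e := x ^+ n.+1 in ee e0 e1.
have uu : fst_ e * fst_ e = fst_ e := congr1 (fun z => fst_ z) ee.
have vv : snd_ e * snd_ e = snd_ e := congr1 (fun z => snd_ z) ee.
have nuu (B : comNzRingType) (u : B) : u * u = u -> (1 - u) * (1 - u) = 1 - u.
  by move=> u2; rewrite mulrBl mul1r mulrBr u2 mulr1 subrr subr0.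
have [u0|u0] := eqVneq (fst_ e) 0.
  case/eqP: e0; apply: amalg_eq => //.
  by apply: idem_nil => //; apply: nilJ; exact: amalg_snd.
have [u1|u1] := eqVneq (fst_ e) 1.
  case/eqP: e1; apply: amalg_eq => //; apply/esym/eqP.
  rewrite -subr_eq0; apply/eqP; apply: idem_nil; first exact: nuu.
  apply: nilJ; apply: (@amalg_snd (1 - e)).
  by change (1 - fst_ e = 0); rewrite u1 subrr.
have [_ + Iadd] := (is_idealP _).1 idR; apply.
rewrite -(subrK (fst_ e) 1) -[1 - _]mul1r; apply: Iadd.
  by exists (fst_ e); rewrite // mulrBl mul1r uu subrr.
by exists (1 - fst_ e); rewrite ?subr_eq0 1?eq_sym // mulrBr mulr1 uu subrr.
Qed.

(** Put [e = (0, e0)]. Then [A] is the product of [A e], a copy of the field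
    [J], and [A (1 - e)], a copy of the domain [R]. A zero-divisor therefore
    has a zero coordinate in one of the factors, so two of them either share a
    factor, whose idempotent annihilates both, or have product zero. *)
Lemma field_domain_within2 (e0 : S) x y : ideal_is_field J e0 -> is_domain R ->
  zdg_vertices x -> zdg_vertices y -> within (@zdg_edge A) 2 x y.
Proof.
move=> [eJ en0 fJ] domR Vx Vy; apply/within2P => //.
have [ee _] := fJ _ eJ; pose e := amalg_of_ideal eJ.
have factor z : zero_divisors z -> z * e = 0 \/ z * (1 - e) = 0.
  move=> [t /eqP t0 zt].
  have zt1 : fst_ z * fst_ t = 0 := congr1 (fun z => fst_ z) zt.
  have zt2 : snd_ z * snd_ t = 0 := congr1 (fun z => snd_ z) zt.
  have [z2|z2] := eqVneq (snd_ z * e0) 0.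
    by left; apply: amalg_eq => //; exact: mulr0.
  have [z1|z1] := eqVneq (fst_ z) 0.
    right; apply: amalg_eq; first by change (fst_ z * (1 - 0) = 0); rewrite z1 mul0r.
    change (snd_ z * (1 - e0) = 0).
    by rewrite mulrBr mulr1 (fJ _ (amalg_snd z1)).1 subrr.
  have t1 : fst_ t = 0 by have /orP[/eqP/eqP|/eqP] := domR _ _ zt1; rewrite ?(negbTE z1).
  case: t0; apply: amalg_eq => //; change (snd_ t = 0).
  have zJ : snd_ z * e0 \in J by rewrite idealMr.
  have [_ /(_ z2)[k zk]] := fJ _ zJ.
  rewrite -(fJ _ (amalg_snd t1)).1 -zk.
  rewrite (_ : _ * _ = snd_ z * snd_ t * (e0 * k)); last by ring.
  by rewrite zt2 mul0r.
have e_neq0 : e != 0 by exact: amalg_of_ideal_neq0.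
have f_neq0 : 1 - e != 0.
  apply/eqP => /(congr1 (fun z => fst_ z)) f0.
  have {f0} : 1 - 0 = 0 :> R := f0.
  by rewrite subr0 => /eqP; rewrite oner_eq0.
case: (factor x Vx.1) (factor y Vy.1) => xe [] ye.
- by right; exists e; rewrite [e * y]mulrC.
- left; rewrite -[x * y]mulr1 -(subrK e 1) mulrDr -mulrA ye mulr0 add0r.
  by rewrite mulrAC xe mul0r.
- left; rewrite -[x * y]mulr1 -(subrK e 1) mulrDr mulrAC xe mul0r add0r.
  by rewrite -mulrA ye mulr0.
- by right; exists (1 - e); rewrite [_ * y]mulrC.
Qed.

(** Since [e] is a multiple of [(0, j)], it has the form [(0, v)]. The nonzero
    elements of [A (1 - e)] divide [1 - e = (1, 1 - v)], so their first
    coordinate is a unit of [R]; hence [(0, k) * (1 - e) = 0] for [k] in [J],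
    which makes [v] a unit element of [J]. *)
Lemma product_of_fields_ideal e j (jJ : j \in J) :
  (forall x, x * e != 0 -> exists y, x * y * e = e) ->
  (forall x, x * (1 - e) != 0 -> exists y, x * y * (1 - e) = 1 - e) ->
  amalg_of_ideal jJ * e != 0 -> (exists u : S, ideal_is_field J u) /\ is_domain R.
Proof.
move=> fe fe' je; have [b jb] := fe _ je.
have e1 : fst_ e = 0.
  have <- : 0 * fst_ b * fst_ e = fst_ e := congr1 (fun z => fst_ z) jb.
  by rewrite !mul0r.
have e0 : e != 0 by apply: contraNneq je => ->; rewrite mulr0.
split.
  exists (snd_ e); split; first exact: amalg_snd.
    by apply: contra_neq e0 => e2; apply: amalg_eq.
  move=> k kJ; have ke : k * snd_ e = k.
    have [k0|/fe'[c kc]] := eqVneq (amalg_of_ideal kJ * (1 - e)) 0.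
      have : k * (1 - snd_ e) = 0 := congr1 (fun z => snd_ z) k0.
      by rewrite mulrBr mulr1 => /eqP; rewrite subr_eq0 => /eqP.
    have : 0 * fst_ c * (1 - fst_ e) = 1 - fst_ e := congr1 (fun z => fst_ z) kc.
    by rewrite e1 subr0 !mul0r => /esym/eqP; rewrite oner_eq0.
  split=> // k0.
  have /fe[c kc] : amalg_of_ideal kJ * e != 0.
    apply: contra_neq k0 => /(congr1 (fun z => snd_ z)) k0.
    have {k0} : k * snd_ e = 0 := k0.
    by rewrite ke.
  exists (snd_ c * snd_ e); rewrite mulrA.
  exact: (congr1 (fun z => snd_ z) kc).
move=> r s rs; have [//|r0] := eqVneq r 0; apply/eqP.
have /fe'[c rc] : amalg_of_ring r * (1 - e) != 0.
  apply: contra_neq r0 => /(congr1 (fun z => fst_ z)) r0.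
  have {r0} : r * (1 - fst_ e) = 0 := r0.
  by rewrite e1 subr0 mulr1.
have : r * fst_ c * (1 - fst_ e) = 1 - fst_ e := congr1 (fun z => fst_ z) rc.
by rewrite e1 subr0 mulr1 => rc1; rewrite -[s]mul1r -rc1 mulrAC rs mul0r.
Qed.

Hypothesis J_neq0 : exists2 j, j \in J & j != 0.

Lemma within0_amalg :
  (forall x y, zdg_vertices x -> zdg_vertices y -> within (@zdg_edge A) 0 x y) <->
  [/\ is_field R, ([set` J] `\ 0 #= `I_1)%card &
      forall i j, i \in J -> j \in J -> i * j = 0].
Proof.
have [j0 j0J j00] := J_neq0.
split=> [w0|[fR cJ d] x y Vx Vy].
  have eqV x y : zdg_vertices x -> zdg_vertices y -> x = y.
    by move=> Vx Vy; exact/within0P/w0.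
  have J1 j : j \in J -> j != 0 -> j = j0.
    move=> jJ jn0; exact: (congr1 (fun x => snd_ x)
      (eqV _ _ (vertex_of_ideal jJ jn0) (vertex_of_ideal j0J j00))).
  split.
  - move=> r r0; have [zr|//] := zero_divisor_or_unit finite_base r.
    have Vr : zdg_vertices (amalg_of_ring r).
      by split; [exact: zero_divisor_of_ring|exact/eqP/amalg_of_ring_neq0].
    case/eqP: r0; exact: (congr1 (fun x => fst_ x) (eqV _ _ Vr (vertex_of_ideal j0J j00))).
  - have -> : [set` J] `\ 0 = [set j0]; last exact: card_set1.
    by apply/seteqP; split=> [j [jJ /eqP jn0]|_ ->]; [exact: J1|split=> //; exact/eqP].
  - move=> i j iJ jJ; have [->|i0] := eqVneq i 0; first by rewrite mul0r.
    have [->|jn0] := eqVneq j 0; first by rewrite mulr0.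
    have [t t0 xt] := zero_divisor_of_ideal iJ.
    have Vt : zdg_vertices t.
      by split; [apply: (zero_divisorI (amalg_of_ideal_neq0 iJ i0)); rewrite mulrC|exact/eqP].
    rewrite (_ : j = snd_ t); first exact: (congr1 (fun x => snd_ x) xt).
    by rewrite (eqV _ _ Vt (vertex_of_ideal jJ jn0)).
apply/within0P.
have x1 z : zdg_vertices z -> fst_ z = 0.
  move=> [/(square0_zero_divisor_fst d) zz _]; apply/eqP; apply: contraT => /fR[s].
  by move=> zs; case: (unit_not_zero_divisor zs zz).
have [j Jj] := eq_cardSP _ _ cJ; rewrite II0 card_eq0 => /eqP J0.
have x2 z : zdg_vertices z -> snd_ z = j.
  move=> Vz; apply: contrapT => zj.
  suff : set0 (snd_ z) by [].
  rewrite -J0; split=> //; split; first exact/amalg_snd/x1.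
  by move=> z2; case: Vz.2; apply: amalg_eq => //; exact: x1.
by apply: amalg_eq; rewrite ?x1 ?x2.
Qed.

Lemma within1_amalg :
  (forall x y, zdg_vertices x -> zdg_vertices y -> within (@zdg_edge A) 1 x y) <->
  ring_isomorphic A ('Z_2 * 'Z_2)%type \/
  (forall x y, zero_divisors x -> zero_divisors y -> x * y = 0).
Proof.
split=> [w1|[[g [h gK hK]]|Z2] x y Vx Vy].
- rewrite or_comm; apply: complete_zdg => x y Vx Vy; exact/within1P/w1.
- apply/within1P => //.
  have [/eqP x0 /eqP y0] := (Vx.2, Vy.2).
  have gz z : zdg_vertices z -> g z = (1, 0) \/ g z = (0, 1).
    move=> [[t /eqP t0 zt] z0].
    have gzt : g z * g t = 0 by rewrite -rmorphM zt rmorph0.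
    have zt1 : (g z).1 * (g t).1 == 0 by apply/eqP; exact: (congr1 (fun c : 'Z_2 * 'Z_2 => c.1) gzt).
    have zt2 : (g z).2 * (g t).2 == 0 by apply/eqP; exact: (congr1 (fun c : 'Z_2 * 'Z_2 => c.2) gzt).
    have z2 (c : 'Z_2) : c = 0 \/ c = 1.
      by case: c => [[|[|//]] ?]; [left|right]; apply: val_inj.
    have gz0 : g z <> (0, 0).
      by move=> gz; apply: z0; apply: (can_inj gK); rewrite gz rmorph0.
    have gt0 : g t <> (0, 0).
      by move=> gt; apply: t0; apply: (can_inj gK); rewrite gt rmorph0.
    move: zt1 zt2 gz0 gt0; case: (g z) (g t) => [a b] [c d] /=.
    by case: (z2 a) => ->; case: (z2 b) => ->; case: (z2 c) => ->; case: (z2 d) => -> //;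
      by [left|right|].
  have gE : g x = g y -> x = y by exact: can_inj gK _ _.
  have gM : (g x).1 * (g y).1 = 0 -> (g x).2 * (g y).2 = 0 -> x * y = 0.
    move=> g1 g2; apply: (can_inj gK); rewrite rmorphM rmorph0.
    exact: injective_projections.
  case: (gz x Vx) (gz y Vy) => gx [] gy.
  - by left; apply: gE; rewrite gx gy.
  - by right; apply: gM; rewrite gx gy /= ?mulr0 ?mul0r.
  - by right; apply: gM; rewrite gx gy /= ?mulr0 ?mul0r.
  - by left; apply: gE; rewrite gx gy.
- by apply/within1P => //; right; exact: Z2 Vx.1 Vy.1.
Qed.

Lemma within2_amalg :
  (forall x y, zdg_vertices x -> zdg_vertices y -> within (@zdg_edge A) 2 x y) <->
  (is_ideal (@zero_divisors R) /\ [set` J] `<=` @nilpotents S) \/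
  [/\ [set` J] `&` @nilpotents S = [set 0],
      exists! q : set S, minimal_prime_avoiding [set` J] q & is_domain R].
Proof.
split=> [w2|[/nilpotent_zero_divisors nil|[red uq dom]] x y Vx Vy]; last 2 first.
- exact: nilpotent_within2.
- have [e fe] := unique_minimal_prime_field finite_ideal red J_neq0 uq.
  exact: field_domain_within2 fe dom Vx Vy.
have [nil|] := pselect (forall x, zero_divisors x -> nilpotents x).
  by left; exact/nilpotent_zero_divisors.
move=> /existsNP[x /not_implyP[zx nx]]; right.
have [n /= [ee e0 e1]] := nontrivial_idempotent finA zx nx.
set e := x ^+ n.+1 in ee e0 e1.
have f1 : 1 - e != 1 by rewrite -subr_eq0 addrAC subrr sub0r oppr_eq0.
have ff : (1 - e) * (1 - e) = 1 - e.
  by rewrite mulrBl mul1r mulrBr ee mulr1 subrr subr0.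
have fe y := diam2_factor_field finA w2 ee e1 (a := y).
have fe' y := diam2_factor_field finA w2 ff f1 (a := y).
suff [[e2 fe2] dom] : (exists u : S, ideal_is_field J u) /\ is_domain R.
  split=> //; first exact: field_ideal_reduced fe2.
  exact: field_unique_minimal_prime finite_ideal _ fe2.
(* The nonzero ideal [J] meets one of the two factors; by symmetry between [e]
   and [1 - e], it does not matter which. *)
have [j jJ j0] := J_neq0.
have [je|je] := eqVneq (amalg_of_ideal jJ * e) 0; last first.
  exact: product_of_fields_ideal fe fe' je.
apply: (@product_of_fields_ideal (1 - e) j jJ) => //.
  by rewrite subKr.
by rewrite mulrBr mulr1 je subr0 amalg_of_ideal_neq0.
Qed.

End Amalgamation.

(** * The diameter *)

Theorem theorem5p4 (R S : comNzRingType) (f : {rmorphism R -> S})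
    (J : idealr S) (J_neq0 : exists2 j, j \in J & j != 0)
    (fin : finite_set [set: amalg f J]) :
  let diam := zdg_diam (amalg f J) in
  let a := forall x y : R, zero_divisors x -> zero_divisors y -> x * y = 0 in
  let b := forall (r : R) (j : S),
    regular_elements r -> j \in J -> j != 0 -> j * f r != 0 in
  let c := forall (r : R) (j : S),
    zero_divisors r -> r != 0 -> j \in J -> j != 0 -> j * f r = 0 in
  let d := forall i j : S, i \in J -> j \in J -> i * j = 0 in
  let abcd := [/\ a, b, c & d] in
  [/\ (diam = 0%:E <->
         [/\ is_field R, ([set` J] `\ 0 #= `I_1)%card & d])
      /\ (diam = 0%:E -> abcd),
      (diam = 1%:E <->
         ring_isomorphic (amalg f J) ('Z_2 * 'Z_2)%type
         \/ abcd /\ (0%:E < diam)%E),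
      (diam = 2%:E <->
         (1%:E < diam)%E
         /\ ((is_ideal (@zero_divisors R) /\ [set` J] `<=` @nilpotents S)
             \/ [/\ [set` J] `&` @nilpotents S = [set 0],
                    exists! q : set S, minimal_prime_avoiding [set` J] q
                  & is_domain R])) &
      (diam = 3%:E <->
         (~ is_ideal (@zero_divisors R) \/ ~ ([set` J] `<=` @nilpotents S))
         /\ [\/ [set` J] `&` @nilpotents S <> [set 0],
                exists q1 q2 : set S,
                  [/\ minimal_prime_avoiding [set` J] q1,
                      minimal_prime_avoiding [set` J] q2 & q1 <> q2]
              | ~ is_domain R])].
Proof.
move=> diam a b c d abcd.
have [m [diamE mP]] := zdg_diamP (amalg f J).
have m3 : (m <= 3)%N by apply/mP; exact: zdg_within3.
have W0 := iff_trans (mP 0%N) (within0_amalg fin J_neq0).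
have W1 := iff_trans (mP 1%N) (within1_amalg f J).
have W2 := iff_trans (mP 2%N) (within2_amalg fin J_neq0).
have abcdP := square0_zero_divisors fin.
have diam_eq k : diam = k%:Z%:E <-> m = k.
  by rewrite /diam diamE; split=> [[->]|->].
have diam_gt k : (k%:Z%:E < diam)%E = (k < m)%N.
  by rewrite /diam diamE lte_fin ltz_nat.
have Z2_m1 : ring_isomorphic (amalg f J) ('Z_2 * 'Z_2)%type -> m <> 0%N.
  move=> iso m0; apply: (Z2xZ2_not_within0 iso); apply/(mP 0%N).
  by rewrite m0.
split.
- split.
    rewrite (diam_eq 0%N) -W0; split=> [->//|]; by rewrite leqn0 => /eqP.
  move=> /(diam_eq 0%N) m0; apply/abcdP.
  have : (m <= 1)%N by rewrite m0.
  by move=> /W1[/Z2_m1|].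
- rewrite (diam_eq 1%N) (diam_gt 0%N); split=> [m1|].
    have /W1[iso|Z2] : (m <= 1)%N by rewrite m1.
      by left.
    by right; rewrite m1; split=> //; exact/abcdP.
  case=> [iso|[/abcdP Z2 m0]].
    have : (m <= 1)%N by apply/W1; left.
    by have := Z2_m1 iso; case: (m) => [|[|]].
  have : (m <= 1)%N by apply/W1; right.
  by case: (m) m0 => [|[|]].
- rewrite (diam_eq 2%N) (diam_gt 1%N) -W2; split=> [->//|[m1 m2]].
  by apply/eqP; rewrite eqn_leq m2.
- rewrite (diam_eq 3%N).
  have -> : m = 3%N <-> ~ (m <= 2)%N by split=> [->//|/negP]; lia.
  rewrite W2; split=> [/not_orP[ni nii]|[ni nii] [[idR nilJ]|[red [q [_ uq]] dom]]].
  + split; first exact/not_andP.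
    have [red|] := pselect ([set` J] `&` @nilpotents S = [set 0]); last by constructor 1.
    have [dom|] := pselect (is_domain R); last by constructor 3.
    constructor 2.
    have [q mq] := minimal_prime_avoiding_exists (finite_ideal fin) red J_neq0.
    apply: contrapT => nq; apply: nii; split=> //.
    exists q; split=> // q' mq'; apply: contrapT => qq'.
    by apply: nq; exists q, q'.
  + by case: ni.
  + case: nii => [//|[q1 [q2 [mq1 mq2 q12]]]|//].
    by apply: q12; rewrite -(uq _ mq1) -(uq _ mq2).
Qed.
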